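(* For every integer $k \geq 1$ there exists $n_0$ such that for all $n \geq n_0$ we have $\mathrm{vp}(K(n,k)) = \binom{n-k}{k}$.
   Context: All graphs are finite, undirected and simple. The Kneser graph $K(n,k)$ has as vertices all $k$-subsets of $\{1,2,\dots,n\}$, with an edge between two such subsets if and only if they are disjoint. A $u,v$-geodesic is a shortest $u,v$-path. For a vertex $x$ of $G$, a set $S \subseteq V(G)$ is an $x$-position set if for every $y \in S$ no vertex of $S \setminus \{y\}$ lies on any $x,y$-geodesic in $G$. The $x$-position number $p_x(G)$ is the maximum cardinality of an $x$-position set of $G$. Define $\mathrm{vp}(G) = \max_{x \in V(G)} p_x(G)$. *)

(* Defs.v *)
From mathcomp Require Import all_boot.
From mathcomp Require Import boolp.

Set Implicit Arguments.
Unset Strict Implicit.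
Unset Printing Implicit Defensive.

(* A finite graph on T is given by its adjacency relation e : rel T. *)
Section PositionSets.
Variables (T : finType) (e : rel T).

(* As in path.v, a path is given by its first vertex x and the sequence p of
   the remaining ones: its vertices are x :: p and its length is size p. *)
Definition graph_path (x y : T) (p : seq T) : bool :=
  [&& path e x p, uniq (x :: p) & last x p == y].

Definition geodesic (x y : T) (p : seq T) : Prop :=
  graph_path x y p /\ forall q, graph_path x y q -> size p <= size q.

Definition position_set (x : T) (S : {set T}) : Prop :=
  forall y, y \in S -> forall z, z \in S :\ y ->
  forall p, geodesic x y p -> z \notin x :: p.

Definition position_number (x : T) : nat :=
  \max_(S : {set T} | `[< position_set x S >]) #|S|.

Definition vp : nat := \max_(x : T) position_number x.

End PositionSets.

(* The ground set {1, ..., n} is represented by 'I_n. *)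
Definition ksubset (n k : nat) : finType := {A : {set 'I_n} | #|A| == k}.

Definition kneser (n k : nat) : rel (ksubset n k) :=
  fun A B => [disjoint val A & val B].

Lemma kneser_sym n k : symmetric (@kneser n k).
Proof. by move=> A B; rewrite /kneser disjoint_sym. Qed.

(* For k = 0 the empty set is disjoint from itself, so kneser n 0 has a loop. *)
Lemma kneser_irr n k : 0 < k -> irreflexive (@kneser n k).
Proof.
move=> k_gt0 A; rewrite /kneser -setI_eq0 setIid -cards_eq0 (eqP (valP A)).
by case: k k_gt0 A.
Qed.

(* Main.v *)
Require Import Defs.
From mathcomp Require Import all_boot.
From mathcomp Require Import boolp.
From mathcomp Require Import zify.

(** The neighbourhood of any vertex is a position set, which gives the lower
    bound 'C(n - k, k).  Conversely, if a position set S based at x contains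
    some y at distance 2 from x, then S misses all common neighbours of x and
    y.  There are at least 'C(n - 2k, k) of these, which for large n is more
    than half of all the vertices, so that S has at most 'C(n - 2k, k)
    elements. *)

Section PositionSets.
Variables (T : finType) (e : rel T).
Hypothesis e_irr : irreflexive e.

Lemma graph_path_edge x y : e x y -> graph_path e x y [:: y].
Proof.
move=> exy; rewrite /graph_path /= exy inE eqxx !andbT.
by apply: contraTneq exy => ->; rewrite e_irr.
Qed.

(** The only geodesic from [x] to a neighbour is a single edge, which has no room for a third
    vertex. *)
Lemma position_set_neighbours x : position_set e x [set y | e x y].
Proof.
move=> y; rewrite inE => exy z; rewrite !inE => /andP[zy exz] p [gp minp].
have := minp _ (graph_path_edge x y exy).
case: p gp {minp} => [|a [|//]] /and3P[_ _ /eqP/= xy] _.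
  by rewrite xy e_irr in exy.
rewrite !inE xy (negPf zy) orbF.
by apply: contraTneq exz => ->; rewrite e_irr.
Qed.

Lemma geodesic_common_neighbour x y z :
  x != y -> ~~ e x y -> e x z -> e z y -> geodesic e x y [:: z; y].
Proof.
move=> xy nexy exz ezy; split; last first.
  case=> [|a [|//]] /and3P[/= + _ /eqP] => [_ xy'|].
    by rewrite xy' eqxx in xy.
  by rewrite andbT => exa ay; rewrite -ay exa in nexy.
rewrite /graph_path /= exz ezy !inE negb_or xy eqxx !andbT /=.
apply/andP; split; first by apply: contraTneq exz => ->; rewrite e_irr.
by apply: contraTneq ezy => ->; rewrite e_irr.
Qed.

(** A common neighbour [z] is the midpoint of the geodesic [x], [z], [y], so it cannot belong to [S]
    together with [y]. *)
Lemma position_set_common_neighbour x y (S : {set T}) :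
  position_set e x S -> y \in S -> x != y -> ~~ e x y ->
  [disjoint S & [set z | e x z && e z y]].
Proof.
move=> posS yS xy nexy; rewrite disjoint_subset; apply/subsetP => z zS.
rewrite !inE; apply/negP => /andP[exz ezy].
have zy : z != y by apply: contraTneq ezy => ->; rewrite e_irr.
have zSy : z \in S :\ y by rewrite !inE zy.
have := posS _ yS _ zSy _ (geodesic_common_neighbour _ _ _ xy nexy exz ezy).
by rewrite !inE eqxx orbT.
Qed.

(** The root lies on every geodesic that starts from it, in particular on the edge to [y]. *)
Lemma position_set_root x y (S : {set T}) :
  position_set e x S -> x \in S -> y \in S -> ~~ e x y.
Proof.
move=> posS xS yS; apply/negP => exy.
have xy : x != y by apply: contraTneq exy => ->; rewrite e_irr.
have xSy : x \in S :\ y by rewrite !inE xy.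
have gy : geodesic e x y [:: y].
  split; first exact: graph_path_edge.
  by case=> [|//] /and3P[_ _ /= /eqP xy']; rewrite xy' eqxx in xy.
by have := posS _ yS _ xSy _ gy; rewrite inE eqxx.
Qed.

End PositionSets.

(** Pascal's rule is applied [j] times, and each term split off is at most ['C(n.-1, k)]. *)
Lemma leq_bin_sub n k j : 'C(n, k.+1) <= 'C(n - j, k.+1) + j * 'C(n.-1, k).
Proof.
elim: j => [|j IHj]; first by rewrite subn0 addn0.
apply: (leq_trans IHj); rewrite mulSn addnA leq_add2r subnS.
(* Once the truncated difference is 0, removing one more element changes nothing. *)
case Dm: (n - j) => [|m]; first exact: leq_addr.
rewrite binS leq_add2l leq_bin2l //; lia.
Qed.

(** For positive [k], at most [2k * 'C(n.-1, k.-1)] subsets are lost. Since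
    [n * 'C(n.-1, k.-1) = k * 'C(n, k)], the bound [4k^2 <= n] makes this at most half of
    ['C(n, k)]. *)
Lemma leq_bin_double n k :
  4 * k ^ 2 <= n -> 'C(n, k) <= 'C(n - k.*2, k).*2.
Proof.
case: k => [|k] len; first by rewrite !bin0.
have := leq_bin_sub n k k.+1.*2.
have := mul_bin_diag n k.
move: 'C(n, _) 'C(n.-1, _) 'C(n - _, _) => a b c.
nia.
Qed.

Lemma card_ksubset_subset n k (B : {set 'I_n}) :
  #|[set A : ksubset n k | val A \subset B]| = 'C(#|B|, k).
Proof.
rewrite -cards_draws -(card_imset _ val_inj); apply: eq_card => A.
rewrite inE; apply/imsetP/andP => [[A' + ->]|[sAB kA]].
  by rewrite inE => sAB; rewrite sAB (valP A').
by exists (exist _ A kA); rewrite // inE.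
Qed.

Lemma card_ksubset n k : #|{: ksubset n k}| = 'C(n, k).
Proof.
rewrite -[in RHS](card_ord n) -!cardsT -card_ksubset_subset.
by apply: eq_card => A; rewrite !inE subsetT.
Qed.

Lemma card_kneser_neighbours n k (x : ksubset n k) :
  #|[set y | kneser x y]| = 'C(n - k, k).
Proof.
have <- : #|~: val x| = n - k by rewrite cardsCs setCK card_ord (eqP (valP x)).
rewrite -card_ksubset_subset; apply: eq_card => y.
by rewrite !inE /kneser disjoint_sym disjoints_subset.
Qed.

(** Common neighbours are the [k]-subsets of the complement of the union of [x] and [y], a union of
    at most [2k] points. *)
Lemma card_kneser_common_neighbours n k (x y : ksubset n k) :
  'C(n - k.*2, k) <= #|[set z | kneser x z && kneser z y]|.
Proof.
have le_xy : n - k.*2 <= #|~: (val x :|: val y)|.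
  rewrite cardsCs setCK card_ord leq_sub2l // cardsU.
  by rewrite (eqP (valP x)) (eqP (valP y)) addnn leq_subr.
apply: leq_trans (leq_bin2l k le_xy) _; rewrite -card_ksubset_subset.
apply/eq_leq/eq_card => z; rewrite !inE /kneser.
by rewrite setCU subsetI -!disjoints_subset disjoint_sym.
Qed.

Lemma kneser_position_set_bound n k (x : ksubset n k) (S : {set ksubset n k}) :
  0 < k -> 4 * k ^ 2 <= n -> position_set (@kneser n k) x S ->
  #|S| <= 'C(n - k, k).
Proof.
move=> k_gt0 len posS; have irr := kneser_irr k_gt0 (n := n).
have [/exists_inP[y yS /andP[xy nexy]]|] :=
    boolP [exists y in S, (x != y) && ~~ kneser x y].
  have dis := position_set_common_neighbour _ _ irr _ _ _ posS yS xy nexy.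
  apply: (@leq_trans 'C(n - k.*2, k)); last by apply: leq_bin2l; lia.
  (* The equality case of the union bound: disjointness makes the cardinalities add up. *)
  have [] := leq_card_setU S [set z | kneser x z && kneser z y].
  rewrite dis => _ /eqP cardU.
  have := max_card (mem (S :|: [set z | kneser x z && kneser z y])).
  rewrite cardU card_ksubset.
  have := leq_bin_double _ _ len.
  have := card_kneser_common_neighbours _ _ x y; lia.
move=> /exists_inPn near.
have {}near y : y \in S -> (x == y) || kneser x y.
  by move=> /near; rewrite negb_and !negbK.
(* Now [S] lies in the closed neighbourhood of [x]. If it contains [x], it contains no neighbour of
   [x] and is just [{x}]. *)
have [xS|xS] := boolP (x \in S).
  apply: (@leq_trans #|[set x]|); last by rewrite cards1 bin_gt0; nia.
  apply/subset_leq_card/subsetP => y yS; rewrite inE eq_sym.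
  have := position_set_root _ _ irr _ _ _ posS xS yS.
  by have /orP[|->] := near y yS.
rewrite -(card_kneser_neighbours _ _ x).
apply/subset_leq_card/subsetP => y yS; rewrite inE.
have /orP[/eqP xy|//] := near y yS.
by rewrite xy yS in xS.
Qed.

Theorem theorem3p8 :
  forall k : nat, 1 <= k ->
  exists n0 : nat, forall n : nat, n0 <= n -> vp (@kneser n k) = 'C(n - k, k).
Proof.
move=> k k_gt0; exists (4 * k ^ 2) => n len; apply/eqP.
rewrite eqn_leq; apply/andP; split.
  apply/bigmax_leqP => x _; apply/bigmax_leqP => S /asboolP.
  exact: kneser_position_set_bound.
(* A maximum over no vertices would be 0, so the lower bound needs an actual vertex. *)
have /card_gt0P[x _] : 0 < #|{: ksubset n k}|.
  by rewrite card_ksubset bin_gt0; nia.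
apply: leq_trans (leq_bigmax x).
rewrite -(card_kneser_neighbours _ _ x) /position_number.
apply: (leq_bigmax_cond (F := fun S : {set ksubset n k} => #|S|)).
apply/asboolP/position_set_neighbours; exact: kneser_irr.
Qed.
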